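(* Let $\mathbf{\Sigma}\in\mathbb{R}^{d\times d}$ be symmetric PSD with eigenvalues $\lambda_1\ge\dots\ge\lambda_d$, orthonormal eigenvectors $v_1,\dots,v_d$, and $\mathrm{gap}=(\lambda_1-\lambda_2)/\lambda_1>0$. Let $(1+\frac{\mathrm{gap}}{150})\lambda_1\le\lambda\le(1+\frac{\mathrm{gap}}{100})\lambda_1$ and $\mathbf{B}=\lambda\mathbf{I}-\mathbf{\Sigma}$. Let $x$ be a unit vector with $\langle x,v_1\rangle\ne0$ and $\tilde x=\mathbf{B}^{-1}x$. Then $$G(\tilde x)\le\frac{\lambda_2(\mathbf{B}^{-1})}{\lambda_1(\mathbf{B}^{-1})}G(x)\le\frac1{100}G(x).$$
   Context: $\lambda_i(\mathbf{B}^{-1})=1/(\lambda-\lambda_i)$ denotes the $i$-th largest eigenvalue of $\mathbf{B}^{-1}$. $\|x\|_{\mathbf{B}}=\sqrt{x^\top\mathbf{B}x}$; $\mathbf{P}_{v_1}$ and $\mathbf{P}_{v_1^\perp}$ are the orthogonal projections onto $\mathrm{span}(v_1)$ and its orthogonal complement; $G(x)=\|\mathbf{P}_{v_1^\perp}x\|_{\mathbf{B}}/\|\mathbf{P}_{v_1}x\|_{\mathbf{B}}$ for $v_1^\top x\ne0$. *)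

(* Defs.v *)
From mathcomp Require Import all_boot all_order all_algebra.
From mathcomp Require Import polyrcf reals.

Set Implicit Arguments.
Unset Strict Implicit.
Unset Printing Implicit Defensive.

Import Order.TTheory GRing.Theory Num.Theory.
Local Open Scope ring_scope.

Section Defs.
Variable R : rcfType.

Definition dotv n (x y : 'cV[R]_n) : R := (x^T *m y) 0 0.

Definition norm2 n (x : 'cV[R]_n) : R := Num.sqrt (dotv x x).

(* ||x||_A; the square root is meaningful when A is positive semidefinite. *)
Definition normB n (A : 'M[R]_n) (x : 'cV[R]_n) : R :=
  Num.sqrt (dotv x (A *m x)).

Definition symmetric_mx n (A : 'M[R]_n) : Prop := A^T = A.

Definition psd_mx n (A : 'M[R]_n) : Prop :=
  symmetric_mx A /\ forall y : 'cV[R]_n, 0 <= dotv y (A *m y).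

Definition orthonormal_family n (v : 'I_n -> 'cV[R]_n) : Prop :=
  forall i j, dotv (v i) (v j) = (i == j)%:R.

(* The real eigenvalues of A in nonincreasing order, each repeated according
   to its multiplicity as a root of the characteristic polynomial
   ([rootsR] lists the distinct roots in increasing order). *)
Definition eigenvalues n (A : 'M[R]_n) : seq R :=
  rev (flatten [seq nseq (mup a (char_poly A)) a | a <- rootsR (char_poly A)]).

(* The k-th largest eigenvalue, counted from k = 1. *)
Definition eig n (A : 'M[R]_n) (k : nat) : R := (eigenvalues A)`_k.-1.

(* A subspace is the row space of a matrix U. *)
Definition orthcompl n (U : 'M[R]_n) : 'M[R]_n := kermx U^T.

(* Transposed because [proj_mx] acts on row vectors by right multiplication,
   whereas here vectors are columns. *)
Definition orthproj n (U : 'M[R]_n) : 'M[R]_n := (proj_mx U (orthcompl U))^T.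

Definition spanv n (v : 'cV[R]_n) : 'M[R]_n := <<v^T>>%MS.

(* G(x) = ||P_{v^perp} x||_B / ||P_v x||_B, meaningful when v^T x != 0. *)
Definition Gratio n (B : 'M[R]_n) (v x : 'cV[R]_n) : R :=
  normB B (orthproj (orthcompl (spanv v)) *m x) /
  normB B (orthproj (spanv v) *m x).

End Defs.

(* Main.v *)
(** Write [x] as the sum of [c i *: v i] and let [b i = l - lam i] be the
    eigenvalues of [B]. Then [G(x)^2] is the sum over [i <> 1] of [b i * c i^2],
    divided by [b 1 * c 1^2]. Applying [B^-1] divides [c i] by [b i], so each
    summand is multiplied by [b i^-2 <= b 2^-2] and the denominator by [b 1^-2].
    Finally [b 1 / b 2 <= 1/100], as [b 1 <= (lam 1 - lam 2) / 100 <= b 2 / 100].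
    Identifying [1 / b i] with [eig B^-1 i] amounts to computing the
    characteristic polynomial of [B^-1] in the basis [v]. *)
Require Import Defs.
From mathcomp Require Import all_boot all_order all_algebra.
From mathcomp Require Import polyrcf reals.
From mathcomp Require Import ring lra.

Set Implicit Arguments.
Unset Strict Implicit.
Unset Printing Implicit Defensive.

Import Order.TTheory GRing.Theory Num.Theory.
Local Open Scope ring_scope.

(** * The Euclidean inner product *)

Section DotProduct.
Variable R : rcfType.

Lemma dotvE n (x y : 'cV[R]_n) : dotv x y = \sum_i x i 0 * y i 0.
Proof. by rewrite /dotv mxE; apply: eq_bigr => i _; rewrite mxE. Qed.

Lemma dotvC n (x y : 'cV[R]_n) : dotv x y = dotv y x.
Proof. by rewrite !dotvE; apply: eq_bigr => i _; rewrite mulrC. Qed.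

Lemma dotvDr n (x y z : 'cV[R]_n) : dotv x (y + z) = dotv x y + dotv x z.
Proof. by rewrite /dotv mulmxDr mxE. Qed.

Lemma dotvZr n a (x y : 'cV[R]_n) : dotv x (a *: y) = a * dotv x y.
Proof. by rewrite /dotv -scalemxAr mxE. Qed.

Lemma dotvBr n (x y z : 'cV[R]_n) : dotv x (y - z) = dotv x y - dotv x z.
Proof. by rewrite dotvDr -scaleN1r dotvZr mulN1r. Qed.

Lemma dotv_sumr n (I : finType) (x : 'cV[R]_n) (F : I -> 'cV[R]_n) :
  dotv x (\sum_i F i) = \sum_i dotv x (F i).
Proof. by rewrite /dotv mulmx_sumr summxE. Qed.

Lemma dotv_eq0 n (x : 'cV[R]_n) : (dotv x x == 0) = (x == 0).
Proof.
apply/eqP/eqP => [|->]; last by rewrite /dotv mulmx0 mxE.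
rewrite dotvE => /eqP; rewrite psumr_eq0 => [/allP x0|i _]; last first.
  by rewrite -expr2 sqr_ge0.
apply/colP => i; rewrite mxE; apply/eqP.
by have := x0 i (mem_index_enum _); rewrite mulf_eq0 orbb.
Qed.

End DotProduct.

(** * Orthogonal projections onto a line and its complement *)

Section OrthogonalProjection.
Variable R : rcfType.

(** A vector of both spaces is orthogonal to itself. Trivial intersection is what makes [proj_mx]
    act as a projection along the complement. *)
Lemma cap_orthcompl n (U : 'M[R]_n) : (U :&: orthcompl U)%MS = 0.
Proof.
apply/eqP/rowV0P => w; rewrite sub_capmx => /andP[/submxP[u wE] /sub_kermxP w0].
apply: trmx_inj; apply/eqP; rewrite trmx0 -dotv_eq0 /dotv trmxK.
by rewrite {2}wE trmx_mul mulmxA w0 mul0mx mxE.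
Qed.

Lemma orthprojD n (U : 'M[R]_n) (y z : 'cV[R]_n) :
  (y^T <= U)%MS -> (z^T <= orthcompl U)%MS -> orthproj U *m (y + z) = y.
Proof.
move=> yU zU; apply: trmx_inj; rewrite trmx_mul trmxK linearD /= mulmxDl.
by rewrite proj_mx_id ?proj_mx_0 ?cap_orthcompl // addr0.
Qed.

Lemma sub_orthcompl_spanv n (v y : 'cV[R]_n) :
  dotv v y = 0 -> (y^T <= orthcompl (spanv v))%MS.
Proof.
move=> vy0; apply/sub_kermxP.
have /submxP[M ->] : (spanv v <= v^T)%MS by rewrite genmxE.
rewrite trmx_mul trmxK mulmxA [y^T *m v]mx11_scalar -[X in X%:M]/(dotv y v).
by rewrite dotvC vy0 mul_scalar_mx scale0r.
Qed.

(** With this inclusion, projecting onto the complement of a line kills the component along the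
    line. *)
Lemma sub_orthcomplK n (U : 'M[R]_n) : (U <= orthcompl (orthcompl U))%MS.
Proof.
by apply/sub_kermxP/trmx_inj; rewrite trmx_mul trmxK trmx0 mulmx_ker.
Qed.

Variables (n : nat) (v : 'cV[R]_n).
Hypothesis v1 : dotv v v = 1.

Let orth_residual y : dotv v (y - dotv v y *: v) = 0.
Proof. by rewrite dotvBr dotvZr v1 mulr1 subrr. Qed.

Let span_component y : ((dotv v y *: v)^T <= spanv v)%MS.
Proof. by rewrite linearZ /= scalemx_sub // genmxE. Qed.

Lemma orthproj_spanv y : orthproj (spanv v) *m y = dotv v y *: v.
Proof.
rewrite -{1}(subrK (dotv v y *: v) y) addrC orthprojD //.
exact/sub_orthcompl_spanv/orth_residual.
Qed.

Lemma orthproj_orthcompl_spanv y :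
  orthproj (orthcompl (spanv v)) *m y = y - dotv v y *: v.
Proof.
rewrite -{1}(subrK (dotv v y *: v) y) orthprojD //.
  exact/sub_orthcompl_spanv/orth_residual.
exact: submx_trans (span_component y) (sub_orthcomplK _).
Qed.

End OrthogonalProjection.

(** * Sorted eigenvalues from a split characteristic polynomial *)

Section Eigenvalues.
Variable R : rcfType.

(** [V] also intertwines the two characteristic matrices; take determinants and cancel the nonzero
    constant [\det V]. *)
Lemma char_poly_similar n (A D V : 'M[R]_n) :
  V \in unitmx -> A *m V = V *m D -> char_poly A = char_poly D.
Proof.
move=> Vu AV.
have : char_poly_mx A *m map_mx polyC V = map_mx polyC V *m char_poly_mx D.
  by rewrite /char_poly_mx mulmxBl mulmxBr -!map_mxM AV scalar_mxC.
move/(congr1 determinant); rewrite !det_mulmx [RHS]mulrC.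
by apply: mulIf; rewrite det_map_mx polyC_eq0 -unitfE.
Qed.

Lemma mup_prod_XsubC (I : finType) (a : I -> R) x :
  mup x (\prod_i ('X - (a i)%:P)) = count_mem x [seq a i | i <- enum I].
Proof.
rewrite -big_enum /=; elim: (enum I) => [|i s IHs] /=.
  by rewrite big_nil mupNroot // rootC oner_eq0.
rewrite big_cons mupM ?polyXsubC_eq0 ?IHs //; last first.
  by rewrite prodf_seq_neq0; apply/allP => j _; rewrite polyXsubC_eq0.
by have := mup_XsubCX 1 x (a i); rewrite expr1 => ->; case: eqP.
Qed.

Lemma count_flatten_nseq (T : eqType) (m : T -> nat) (s : seq T) x : uniq s ->
  count_mem x (flatten [seq nseq (m a) a | a <- s]) = ((x \in s) * m x)%N.
Proof.
elim: s => //= a s IHs /andP[as_ us].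
rewrite count_cat IHs // count_nseq inE /= [x == a]eq_sym.
case: (eqVneq a x) => [<-|_] /=; last by rewrite mul0n.
by rewrite (negPf as_) !mul1n addn0.
Qed.

Lemma flatten_nseq_sorted (m : R -> nat) (s : seq R) :
  sorted <%R s -> sorted <=%R (flatten [seq nseq (m a) a | a <- s]).
Proof.
rewrite lt_sorted_pairwise le_sorted_pairwise; elim: s => //= a s IHs.
move=> /andP[/allP a_lt /IHs{}IHs]; rewrite pairwise_cat IHs andbT.
apply/andP; split.
  apply/allrelP => x y /nseqP[-> _] /flatten_mapP[b bs /nseqP[-> _]].
  exact/ltW/a_lt.
elim: (m a) => //= k ->; rewrite andbT.
by apply/allP => y /nseqP[-> _].
Qed.

(** Once reversed, both lists are nondecreasing, and each value occurs in both as often as its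
    multiplicity as a root, so they coincide. *)
Lemma eigenvaluesE n (A : 'M[R]_n) (a : 'I_n -> R) :
  char_poly A = \prod_i ('X - (a i)%:P) ->
  (forall i j : 'I_n, (i <= j)%N -> a j <= a i) ->
  eigenvalues A = [seq a i | i <- enum 'I_n].
Proof.
move=> pE a_ni; apply: (can_inj revK); rewrite /eigenvalues revK.
have p0 : char_poly A != 0 by rewrite monic_neq0 // char_poly_monic.
have rs : sorted <%R (rootsR (char_poly A)) by exact: sorted_roots.
apply: le_sorted_eq; first exact: flatten_nseq_sorted.
  rewrite rev_sorted sorted_map.
  have : sorted ltn [seq val i | i <- enum 'I_n].
    by rewrite val_enum_ord iota_ltn_sorted.
  by rewrite sorted_map; apply: sub_sorted => i j /= /ltnW /a_ni.
apply/allP => x _; apply/eqP.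
rewrite /= count_flatten_nseq; last exact: lt_sorted_uniq rs.
rewrite count_rev -mup_prod_XsubC -pE.
(* Membership in [rootsR] is being a root, and a value that is not a root has multiplicity 0. *)
have := roots_on_rootsR p0 x; rewrite in_itv /= => <-.
by case: (boolP (root _ _)) => [_|/mupNroot->]; rewrite ?mul1n ?muln0.
Qed.

End Eigenvalues.

(** * Matrices diagonal in an orthonormal basis *)

Section Eigenbasis.
Variables (R : rcfType) (n : nat) (v : 'I_n -> 'cV[R]_n).
Hypothesis v_on : orthonormal_family v.

Let V : 'M[R]_n := \matrix_(i, j) v j i 0.

Let VTV : V^T *m V = 1%:M.
Proof.
apply/matrixP => i j; rewrite [RHS]mxE -v_on dotvE mxE.
by apply: eq_bigr => k _; rewrite !mxE.
Qed.

Let V_unit : V \in unitmx. Proof. by have [] := mulmx1_unit VTV. Qed.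

(** Since [V] is square, [V^T *m V = 1] gives [V *m V^T = 1], which read columnwise is this
    expansion. *)
Lemma orthonormal_expansion y : y = \sum_i dotv (v i) y *: v i.
Proof.
rewrite -[LHS]mul1mx -(mulmx1C VTV) -mulmxA; apply/colP => k.
rewrite summxE mxE; apply: eq_bigr => i _; rewrite !mxE mulrC dotvE.
by congr (_ * _); apply: eq_bigr => j _; rewrite !mxE.
Qed.

Lemma dotv_orthonormal_sum (c : 'I_n -> R) i :
  dotv (v i) (\sum_j c j *: v j) = c i.
Proof.
rewrite dotv_sumr (bigD1 i) //= dotvZr v_on eqxx mulr1 big1 ?addr0 // => j ji.
by rewrite dotvZr v_on eq_sym (negPf ji) mulr0.
Qed.

Variables (A : 'M[R]_n) (a : 'I_n -> R).
Hypothesis Av : forall i, A *m v i = a i *: v i.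

Lemma mulmx_eigenbasis y : A *m y = \sum_i (a i * dotv (v i) y) *: v i.
Proof.
rewrite {1}(orthonormal_expansion y) mulmx_sumr; apply: eq_bigr => i _.
by rewrite -scalemxAr Av scalerA mulrC.
Qed.

Lemma dotv_eigenbasis y :
  dotv y (A *m y) = \sum_i a i * dotv (v i) y ^+ 2.
Proof.
rewrite mulmx_eigenbasis dotv_sumr; apply: eq_bigr => i _.
by rewrite dotvZr [dotv y _]dotvC; ring.
Qed.

Let AV : A *m V = V *m diag_mx (\row_i a i).
Proof.
rewrite mul_mx_diag; apply/matrixP => i j; rewrite !mxE.
have /colP/(_ i) := Av j; rewrite !mxE mulrC => <-.
by apply: eq_bigr => k _; rewrite !mxE.
Qed.

(** [A] is similar to the diagonal matrix of the [a i]. Ordinals start at 0 and [eig] counts from 1,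
    hence [i.+1]. *)
Lemma eig_eigenbasis (i : 'I_n) :
  (forall i j : 'I_n, (i <= j)%N -> a j <= a i) -> eig A i.+1 = a i.
Proof.
move=> a_ni; rewrite /eig (@eigenvaluesE _ _ _ a) //=.
  by rewrite (nth_map i) ?size_enum_ord // nth_ord_enum.
rewrite (char_poly_similar V_unit AV) char_poly_trig ?diag_mx_is_trig //.
by apply: eq_bigr => j _; rewrite !mxE eqxx mulr1n.
Qed.

Lemma invmx_eigenbasis (i : 'I_n) :
  (forall i, a i != 0) -> invmx A *m v i = (a i)^-1 *: v i.
Proof.
move=> a0; suff A_unit : A \in unitmx.
  rewrite -{1}[v i]scale1r -(mulVf (a0 i)) -scalerA -Av -scalemxAr.
  by rewrite mulKmx.
have : A *m V \in unitmx.
  rewrite AV unitmx_mul V_unit unitmxE det_diag unitfE.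
  by apply/prodf_neq0 => j _; rewrite mxE.
by rewrite unitmx_mul V_unit andbT.
Qed.

(** One projection keeps only coordinate [i], the other removes it, and the squared [A]-norm is
    diagonal in these coordinates. *)
Lemma Gratio_eigenbasis i y :
  Gratio A (v i) y = Num.sqrt (\sum_(j | j != i) a j * dotv (v j) y ^+ 2) /
                     Num.sqrt (a i * dotv (v i) y ^+ 2).
Proof.
have vi : dotv (v i) (v i) = 1 by rewrite v_on eqxx.
rewrite /Gratio /normB !dotv_eigenbasis orthproj_spanv //.
rewrite orthproj_orthcompl_spanv //; congr (Num.sqrt _ / Num.sqrt _).
  rewrite (bigD1 i) //= dotvBr dotvZr vi mulr1 subrr expr0n mulr0 add0r.
  apply: eq_bigr => j ji; rewrite dotvBr dotvZr v_on (negPf ji).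
  by rewrite mulr0 subr0.
rewrite (bigD1 i) //= dotvZr vi mulr1 big1 ?addr0 // => j ji.
by rewrite dotvZr v_on (negPf ji) mulr0 expr0n mulr0.
Qed.

End Eigenbasis.

Lemma Gratio_invmx_le (R : rcfType) n (v : 'I_n -> 'cV[R]_n) (B : 'M[R]_n)
    (b : 'I_n -> R) (i k : 'I_n) x :
  orthonormal_family v -> (forall j, B *m v j = b j *: v j) ->
  (forall j, 0 < b j) -> (forall j, j != i -> b k <= b j) ->
  Gratio B (v i) (invmx B *m x) <= (b k)^-1 / (b i)^-1 * Gratio B (v i) x.
Proof.
move=> v_on Bv b0 bk.
have Biv j : invmx B *m v j = (b j)^-1 *: v j.
  by apply: invmx_eigenbasis => // m; rewrite gt_eqF.
have cE j : dotv (v j) (invmx B *m x) = (b j)^-1 * dotv (v j) x.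
  by rewrite (mulmx_eigenbasis v_on Biv) dotv_orthonormal_sum.
rewrite !(Gratio_eigenbasis v_on Bv) !cE.
have -> : b i * ((b i)^-1 * dotv (v i) x) ^+ 2
        = (b i)^-1 ^+ 2 * (b i * dotv (v i) x ^+ 2) by ring.
rewrite (sqrtrM _ (sqr_ge0 _)) sqrtr_sqr ger0_norm ?invr_ge0 ?(ltW (b0 i)) //.
set s := Num.sqrt (\sum_(j | _) b j * dotv (v j) x ^+ 2).
set t := Num.sqrt (b i * _).
have -> : (b k)^-1 / (b i)^-1 * (s / t) = (b k)^-1 * s / ((b i)^-1 * t).
  by rewrite invfM; ring.
(* Both sides now have the same denominator, so only numerators are compared; if [t] is 0, both
   quotients are 0 by convention. *)
rewrite ler_wpM2r ?invr_ge0 ?mulr_ge0 ?sqrtr_ge0 ?invr_ge0 ?(ltW (b0 i)) //.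
(* The factor [(b k)^-1] moves under the root as its square, reducing the claim to a termwise
   comparison of sums. *)
rewrite -[(b k)^-1]ger0_norm ?invr_ge0 ?(ltW (b0 k)) // -sqrtr_sqr.
rewrite -sqrtrM ?sqr_ge0 // ler_wsqrtr // mulr_sumr.
apply: ler_sum => j ji; rewrite cE.
have -> : b j * ((b j)^-1 * dotv (v j) x) ^+ 2
        = (b j)^-1 ^+ 2 * (b j * dotv (v j) x ^+ 2) by ring.
rewrite ler_wpM2r ?(mulr_ge0 (ltW (b0 j)) (sqr_ge0 _)) //.
rewrite lerXn2r ?nnegrE ?invr_ge0 ?(ltW (b0 _)) //.
by rewrite lef_pV2 ?posrE ?bk.
Qed.

Theorem theorem3p4 (R : realType) (d : nat) (hd : (2 <= d)%N)
    (Sigma : 'M[R]_d) (lam : 'I_d -> R) (v : 'I_d -> 'cV[R]_d)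
    (i1 : 'I_d := Ordinal (ltnW hd)) (i2 : 'I_d := Ordinal hd)
    (gap : R := (lam i1 - lam i2) / lam i1)
    (hSigma : psd_mx Sigma)
    (hlam : forall i j : 'I_d, (i <= j)%N -> lam j <= lam i)
    (hv : orthonormal_family v)
    (heig : forall i, Sigma *m v i = lam i *: v i)
    (hgap : 0 < gap)
    (l : R)
    (hl : (1 + gap / 150%:R) * lam i1 <= l <= (1 + gap / 100%:R) * lam i1)
    (B : 'M[R]_d := l%:M - Sigma)
    (x : 'cV[R]_d) (hx : norm2 x = 1) (hxv : dotv x (v i1) != 0)
    (xt : 'cV[R]_d := invmx B *m x) :
  Gratio B (v i1) xt
    <= eig (invmx B) 2 / eig (invmx B) 1 * Gratio B (v i1) x
  /\ eig (invmx B) 2 / eig (invmx B) 1 * Gratio B (v i1) x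
    <= 1 / 100%:R * Gratio B (v i1) x.
Proof.
have lam1_ge0 : 0 <= lam i1.
  by have := hSigma.2 (v i1); rewrite heig dotvZr hv eqxx mulr1.
(* Division by 0 yields 0, so a zero [lam i1] would make [gap] zero. *)
have lam1_neq0 : lam i1 != 0.
  by apply: contraTneq hgap => lam0; rewrite /gap lam0 invr0 mulr0 ltxx.
have lam1_gt0 : 0 < lam i1 by rewrite lt_def lam1_neq0.
have gapE : gap * lam i1 = lam i1 - lam i2 by rewrite divfK.
have lam12 : 0 < lam i1 - lam i2 by rewrite -gapE mulr_gt0.
(* Replacing [gap * lam i1] by [lam i1 - lam i2] makes the bounds on [l] linear. The lower one makes
   [B] positive definite, the upper one gives the factor 1/100. *)
have [l_lo l_hi] : l - lam i1 >= (lam i1 - lam i2) / 150%:R /\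
                   l - lam i1 <= (lam i1 - lam i2) / 100%:R.
  by case/andP: hl; rewrite -gapE => l_lo l_hi; split; lra.
have b_gt0 j : 0 < l - lam j.
  have := @hlam i1 j isT => lamj; lra.
have Bv j : B *m v j = (l - lam j) *: v j.
  by rewrite mulmxBl heig mul_scalar_mx scalerBl.
have Biv j : invmx B *m v j = (l - lam j)^-1 *: v j.
  by apply: (invmx_eigenbasis hv Bv) => m; rewrite gt_eqF.
(* On values below [l], the map sending [t] to [1 / (l - t)] is increasing, so [invmx B] orders its
   eigenvalues as [Sigma] does. *)
have Bi_ni (i j : 'I_d) : (i <= j)%N -> (l - lam j)^-1 <= (l - lam i)^-1.
  by move=> ij; rewrite lef_pV2 ?posrE // lerB // hlam.
have -> : eig (invmx B) 1 = (l - lam i1)^-1.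
  exact: (eig_eigenbasis hv Biv i1 Bi_ni).
have -> : eig (invmx B) 2 = (l - lam i2)^-1.
  exact: (eig_eigenbasis hv Biv i2 Bi_ni).
split.
  apply: (@Gratio_invmx_le _ _ _ _ (fun j => l - lam j) i1 i2) => // j j1.
  rewrite lerB // hlam //= lt0n.
  by apply: contra j1 => /eqP j0; apply/eqP/val_inj.
apply: ler_wpM2r; first by rewrite divr_ge0 ?sqrtr_ge0.
rewrite invrK mulrC ler_pdivrMr ?b_gt0 //.
(* As [l] exceeds [lam i1], [lam i1 - lam i2] is at most [l - lam i2]; combine with [l_hi]. *)
have := b_gt0 i1; lra.
Qed.
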